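(* Let $K$ be a field of characteristic $2$ and let $\mathbf L=\mathrm{Lie}_p(v_1,v_2)$ be the Fibonacci restricted Lie algebra over $K$. Let $0\ne a\in\mathbf L$ be written via the basis $\tilde W$ of $\mathbf L$ as $a=\sum_{j=n}^{m} r_{j-3}v_j$ with $1\le n\le m$ and $r_{j-3}\in R$. Then $$a^{2^{\,m-n+2}}=0.$$
   Context: $R=K[t_i\mid i\ge 0]/(t_i^2\mid i\ge 0)$ is the truncated polynomial ring over the field $K$ of characteristic $p=2$, and $\partial_i=\partial/\partial t_i\in\mathrm{Der}\,R$. The pivot elements are the derivations of $R$ $$v_i=\partial_i+t_{i-1}(\partial_{i+1}+t_i(\partial_{i+2}+t_{i+1}(\partial_{i+3}+\cdots))),\qquad i\ge 1,$$ so that $v_i=\partial_i+t_{i-1}v_{i+1}$ (the infinite sum acts on $R$ in a well-defined way). $\mathbf L=\mathrm{Lie}_p(v_1,v_2)$ is the restricted Lie subalgebra of $\mathrm{Der}\,R$ generated by $v_1,v_2$, i.e. the smallest subspace containing $v_1,v_2$ closed under the Lie bracket and under squaring in $\mathrm{End}\,R$. Powers of $a$ are taken in $\mathrm{End}\,R$. The set $\tilde W$ is a $K$-basis of $\mathbf L$, where $\tilde W=\bigcup_{n\ge1}\tilde W_n$, $\tilde W_n=W_n$ for $n=1,2$, $\tilde W_n=W_n\cup\{t_{n-3}v_n\}$ for $n\ge 3$, and $W_n=\{t_0^{\alpha_0}\cdots t_{n-4}^{\alpha_{n-4}}v_n\mid \alpha_i\in\{0,1\}\}$ (so $W_i=\{v_i\}$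 for $i=1,2,3$). Collecting the basis elements involving the same $v_j$, each $a\in\mathbf L$ is written as a finite sum $\sum_j r_{j-3}v_j$, where $r_{j-3}$ is a $K$-linear combination of the coefficients (products of the $t_i$, $0\le i\le j-3$) occurring in $\tilde W_j$; it is a scalar for $j\le 2$. *)

(* Defs.v *)
From HB Require Import structures.
From mathcomp Require Import all_boot all_algebra.
From mathcomp Require Import generic_quotient ring_quotient.
From mathcomp Require Import finmap monalg.
From mathcomp Require Import boolp classical_sets functions cardinality fsbigop.

Set Implicit Arguments.
Unset Strict Implicit.
Unset Printing Implicit Defensive.

Import GRing.Theory.

Local Open Scope quotient_scope.
Local Open Scope classical_set_scope.
Local Open Scope ring_scope.

Notation polyRing K := {malg K[{cmonom nat}]}.

(* The locked definitions below are locked for efficiency only: comparing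
   distinct monomials by unfolding is prohibitively slow. *)
HB.lock Definition polyVar (K : fieldType) (i : nat) : polyRing K :=
  mkmalgU (ucm i) 1.

(* Membership in the ideal (t_i^2 | i >= 0); boolean because quotients of
   rings are taken by boolean predicates. *)
Definition sqIdeal (K : fieldType) (p : polyRing K) : bool :=
  `[< exists s : seq (polyRing K * nat),
        p = \sum_(x <- s) x.1 * polyVar K x.2 ^+ 2 >].

Lemma malgMU (K : fieldType) (c : K) (k k' : {cmonom nat}) :
  mkmalgU k c * mkmalgU k' 1 = mkmalgU (mmul k k') c :> polyRing K.
Proof. by rewrite malgM_def fgmulUU mulr1. Qed.

Lemma polyVar2 (K : fieldType) (j : nat) :
  polyVar K j ^+ 2 = mkmalgU (mmul (ucm j) (ucm j)) 1.
Proof. by rewrite expr2 polyVar.unlock malgMU. Qed.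

Lemma sqIdealP (K : fieldType) (p : polyRing K) :
  sqIdeal p <-> (forall m, m \in msupp p -> exists j, (2 <= m j)%N).
Proof.
split=> [/asboolP[s ->] m|H]; last first.
  apply/asboolP.
  have [f fP] : {f : {cmonom nat} -> nat &
      forall m, m \in msupp p -> (2 <= m (f m))%N}.
    apply: (@boolp.choice _ _ (fun m j => m \in msupp p -> (2 <= m j)%N)) => m.
    have [/H[j ?]|_] := boolP (m \in msupp p); first by exists j.
    by exists 0%N.
  exists [seq (mkmalgU (divcm m (mmul (ucm (f m)) (ucm (f m)))) p@_m, f m)
         | m <- msupp p].
  rewrite [LHS]monalgE big_map [LHS]big_seq [RHS]big_seq.
  apply: eq_bigr => m mp; rewrite -[RHS]/(_ * polyVar K (f m) ^+ 2).
  rewrite polyVar2 malgMU; apply: (congr1 (fun k => mkmalgU k p@_m)).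
  apply/eqP/cmP => j; rewrite mulcmE divcmE cmM !cmU.
  have := fP _ mp; have [<-|_] := eqVneq (f m) j => /= h.
    by rewrite subnK.
  by rewrite !addn0 subn0.
rewrite -mcoeff_neq0 raddf_sum /= => /eqP Sn0.
have [|/negP hs] := boolP (has (fun x => (x.1 * polyVar K x.2 ^+ 2)@_m != 0) s).
  case/hasP => -[q j] _; rewrite mcoeff_neq0 polyVar2 => /msuppM_le[k1 [k2]] /=.
  rewrite msuppU1 => -[_ /fset1P -> ->].
  by exists j; rewrite !cmM !cmU eqxx addnC.
case: Sn0; rewrite big_seq big1 // => x xs; apply/eqP/negPn/negP => h.
by apply: hs; apply/hasP; exists x.
Qed.

Lemma sqIdeal_closed (K : fieldType) : idealr_closed (@sqIdeal K).
Proof.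
split=> [||a p q /asboolP[s ->] /asboolP[s' ->]].
- by apply/asboolP; exists [::]; rewrite big_nil.
- apply/negP => /sqIdealP /(_ mone); rewrite -mcoeff_neq0 mcoeff1 eqxx.
  by case=> [|j]; rewrite ?oner_neq0 // cm1.
- apply/asboolP; exists ([seq (a * x.1, x.2) | x <- s] ++ s').
  rewrite big_cat big_map mulr_sumr; apply: (congr1 (+%R^~ _)).
  by apply: eq_bigr => x _; exact: mulrA.
Qed.

HB.instance Definition _ (K : fieldType) :=
  isIdealr.Build (polyRing K) (@sqIdeal K) (@sqIdeal_closed K).

Definition truncRing (K : fieldType) : Type :=
  {ideal_quot (@sqIdeal K : idealr (polyRing K))}.
HB.instance Definition _ (K : fieldType) := GRing.ComNzRing.on (truncRing K).
HB.instance Definition _ (K : fieldType) := EqQuotient.on (truncRing K).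

HB.lock Definition truncPi (K : fieldType) (p : polyRing K) : truncRing K :=
  \pi_(truncRing K) p.

Lemma truncPi_is_zmod_morphism (K : fieldType) : zmod_morphism (@truncPi K).
Proof.
by move=> p q; rewrite truncPi.unlock; exact: (pi_is_zmod_morphism {ideal_quot _}).
Qed.

Lemma truncPi_is_monoid_morphism (K : fieldType) : monoid_morphism (@truncPi K).
Proof.
rewrite truncPi.unlock; exact: (pi_is_monoid_morphism {ideal_quot _}).
Qed.

HB.instance Definition _ (K : fieldType) :=
  GRing.isZmodMorphism.Build (polyRing K) (truncRing K) (@truncPi K)
    (@truncPi_is_zmod_morphism K).
HB.instance Definition _ (K : fieldType) :=
  GRing.isMonoidMorphism.Build (polyRing K) (truncRing K) (@truncPi K)
    (@truncPi_is_monoid_morphism K).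

Lemma truncPi_eq0 (K : fieldType) (p : polyRing K) :
  (truncPi p == 0) = sqIdeal p.
Proof.
have -> : 0 = truncPi 0 :> truncRing K by rewrite raddf0.
rewrite truncPi.unlock -[p in RHS]subr0.
exact/esym/(@Quotient.idealrBE (polyRing K) (@sqIdeal K : idealr _) p 0).
Qed.

Lemma truncPiK (K : fieldType) (r : truncRing K) : truncPi (repr r) = r.
Proof. by rewrite truncPi.unlock reprK. Qed.

HB.lock Definition truncC (K : fieldType) (c : K) : truncRing K :=
  truncPi c%:MP.

Lemma truncCD (K : fieldType) : {morph (@truncC K) : a b / a + b}.
Proof. by move=> a b; rewrite truncC.unlock !raddfD. Qed.

Lemma truncCM (K : fieldType) : {morph (@truncC K) : a b / a * b}.
Proof. by move=> a b; rewrite truncC.unlock mpolyCM rmorphM. Qed.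

Lemma truncC1 (K : fieldType) : truncC (1 : K) = 1.
Proof. by rewrite truncC.unlock mpolyC1E rmorph1. Qed.

Definition trunc_scale (K : fieldType) (c : K) (r : truncRing K) :
  truncRing K := truncC c * r.

Lemma trunc_scaleA (K : fieldType) (a b : K) (r : truncRing K) :
  trunc_scale a (trunc_scale b r) = trunc_scale (a * b) r.
Proof. by rewrite /trunc_scale truncCM mulrA. Qed.

Lemma trunc_scale1 (K : fieldType) : left_id 1 (@trunc_scale K).
Proof. by move=> r; rewrite /trunc_scale truncC1 mul1r. Qed.

Lemma trunc_scaleDr (K : fieldType) : right_distributive (@trunc_scale K) +%R.
Proof. by move=> c r s; rewrite /trunc_scale mulrDr. Qed.

Lemma trunc_scaleDl (K : fieldType) (r : truncRing K) :
  {morph (@trunc_scale K)^~ r : a b / a + b}.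
Proof. by move=> a b; rewrite /trunc_scale truncCD mulrDl. Qed.

HB.instance Definition _ (K : fieldType) :=
  GRing.Zmodule_isLmodule.Build K (truncRing K)
    (@trunc_scaleA K) (@trunc_scale1 K) (@trunc_scaleDr K) (@trunc_scaleDl K).

Lemma truncPiZ (K : fieldType) (c : K) (p : polyRing K) :
  truncPi (c *: p) = c *: truncPi p.
Proof.
by rewrite -[RHS]/(truncC c * truncPi p) truncC.unlock -mul_malgC rmorphM.
Qed.

Definition truncVar (K : fieldType) (i : nat) : truncRing K :=
  truncPi (polyVar K i).

HB.lock Definition polyPartial (K : fieldType) (i : nat) (p : polyRing K) :
  polyRing K := \sum_(m <- msupp p) mkmalgU (divcm m (ucm i)) (p@_m *+ m i).

Lemma mcoeff_polyPartial (K : fieldType) (i : nat) (p : polyRing K) k :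
  (polyPartial i p)@_k = p@_(mmul k (ucm i)) *+ (k i).+1.
Proof.
have kiE : (mmul k (ucm i)) i = (k i).+1 by rewrite cmM cmUU addn1.
have kiD : divcm (mmul k (ucm i)) (ucm i) = k.
  by apply/eqP/cmP => j; rewrite divcmE cmM addnK.
rewrite polyPartial.unlock raddf_sum; transitivity (\sum_(m <- msupp p)
    (if m == mmul k (ucm i) then p@_m *+ m i else 0)).
  apply: eq_bigr => m _; rewrite -[LHS]/(mcoeff _ _) mcoeffU.
  case: (eqVneq m (mmul k (ucm i))) => [->|mk].
    by rewrite kiD eqxx.
  case: (posnP (m i)) => [->|mi]; first by rewrite mulr0n mul0rn.
  case: eqVneq => // dk; case/eqP: mk.
  apply/eqP/cmP => j; rewrite -dk cmM divcmE cmU.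
  by case: eqVneq => [<-|_]; rewrite ?subnK // subn0 addn0.
rewrite -big_mkcond; case: (boolP (mmul k (ucm i) \in msupp p)) => kp.
  by rewrite -big_filter filter_pred1_uniq ?fset_uniq // big_seq1 kiE.
rewrite (mcoeff_outdom kp) mul0rn big_seq_cond big1 // => m /andP[mp /eqP mk].
by rewrite -mk mp in kp.
Qed.

Lemma polyPartial_sqIdeal (K : fieldType) (i : nat) (p : polyRing K) :
  2%N \in [pchar K] -> sqIdeal p -> sqIdeal (polyPartial i p).
Proof.
move=> K2 /sqIdealP Ip; apply/sqIdealP => k.
rewrite -mcoeff_neq0 mcoeff_polyPartial => nz.
have /Ip[j] : mmul k (ucm i) \in msupp p.
  by rewrite -mcoeff_neq0; apply: contraNneq nz => ->; rewrite mul0rn.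
rewrite cmM cmU; case: (eqVneq i j) => [<-|_]; last by rewrite addn0; exists j.
rewrite addn1 ltnS => ki; exists i; rewrite ltn_neqAle ki andbT.
apply: contraNneq nz => <-.
by rewrite -mulr_natl (pcharf0 K2) mul0r.
Qed.

Lemma polyPartial_is_zmod_morphism (K : fieldType) (i : nat) :
  zmod_morphism (@polyPartial K i).
Proof.
move=> p q; apply/malgP => k.
by rewrite mcoeffB !mcoeff_polyPartial mcoeffB mulrnBl.
Qed.

HB.instance Definition _ (K : fieldType) (i : nat) :=
  GRing.isZmodMorphism.Build (polyRing K) (polyRing K) (@polyPartial K i)
    (@polyPartial_is_zmod_morphism K i).

(* Independent of the choice of the representative in characteristic 2, see
   truncPartial_pi. *)
HB.lock Definition truncPartial (K : fieldType) (i : nat) (r : truncRing K) :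
  truncRing K := truncPi (polyPartial i (repr r)).

Lemma truncPartial_pi (K : fieldType) (i : nat) (p : polyRing K) :
  2%N \in [pchar K] -> truncPartial i (truncPi p) = truncPi (polyPartial i p).
Proof.
move=> K2; rewrite truncPartial.unlock; apply/eqP.
rewrite -subr_eq0 -!raddfB truncPi_eq0; apply: polyPartial_sqIdeal => //.
by rewrite -truncPi_eq0 raddfB /= truncPiK subrr.
Qed.

Lemma truncPartial_finite (K : fieldType) (r : truncRing K) :
  exists N, forall j, (N <= j)%N -> truncPartial j r = 0.
Proof.
exists (\max_(m <- msupp (repr r)) \max_(i <- finsupp m) i.+1)%N => j Nj.
rewrite truncPartial.unlock polyPartial.unlock big_seq big1 ?raddf0 // => m mr.
rewrite (_ : m j = 0%N) ?mulr0n ?monalgU0 //.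
apply/eqP; rewrite cmE_eq0; apply/negP => jm.
have jm_le : (j.+1 <= \max_(i <- finsupp m) i.+1)%N.
  exact: (@leq_bigmax_seq _ (enum_fset (finsupp m)) xpredT (fun i => i.+1) j jm isT).
have := leq_trans jm_le (@leq_bigmax_seq _ (enum_fset (msupp (repr r))) xpredT
  (fun m : {cmonom nat} => \max_(i <- finsupp m) i.+1)%N m mr isT).
by move/leq_trans/(_ Nj); rewrite ltnn.
Qed.

(* The coefficient of the j-th partial derivative in the expansion of v_i is
   t_(i-1) ... t_(j-2). All but finitely many terms of the sum vanish. *)
Definition pivot (K : fieldType) (i : nat) (r : truncRing K) : truncRing K :=
  \sum_(j \in [set j | (i <= j)%N])
     (\prod_(i.-1 <= k < j.-1) truncVar K k) * truncPartial j r.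

Lemma pivotE (K : fieldType) (i N : nat) (r : truncRing K) :
  (forall j, (N <= j)%N -> truncPartial j r = 0) ->
  pivot i r = \sum_(i <= j < N)
     (\prod_(i.-1 <= k < j.-1) truncVar K k) * truncPartial j r.
Proof.
move=> hN; rewrite /pivot (fsbigE (index_iota i N)) ?iota_uniq //=.
- rewrite big_seq_cond [RHS]big_seq; apply: eq_bigl => j.
  case: (boolP (j \in index_iota i N)) => //=.
  by rewrite mem_index_iota => /andP[ij _]; apply/mem_set.
- by move=> j /=; rewrite mem_index_iota => /andP[].
- move=> j ij; rewrite mem_index_iota ij /= -leqNgt => /hN ->.
  by rewrite mulr0.
Qed.

Lemma pivot_rec (K : fieldType) (i : nat) (r : truncRing K) : (0 < i)%N ->
  pivot i r = truncPartial i r + truncVar K i.-1 * pivot i.+1 r.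
Proof.
move=> i0; have [N hN] := truncPartial_finite r.
have hM j : (N + i.+1 <= j)%N -> truncPartial j r = 0.
  by move=> h; apply: hN; apply: leq_trans h; rewrite leq_addr.
rewrite !(pivotE _ hM) big_ltn; last by rewrite addnS ltnS leq_addl.
rewrite big_geq // mul1r mulr_sumr; congr (_ + _).
rewrite [LHS]big_nat [RHS]big_nat; apply: eq_bigr => j /andP[ij _].
rewrite mulrA; congr (_ * _); rewrite big_ltn ?prednK //.
by case: j ij.
Qed.

(* Products in End R are compositions \o, not the pointwise products of the
   library's ring structure on functions. *)
Definition restricted_Lie_subalgebra (K : fieldType)
    (A : set (truncRing K -> truncRing K)) : Prop :=
  [/\ A `<=` [set f | linear f],
      GRing.submod_closed [in A],
      forall f g, A f -> A g -> A ((f \o g) - (g \o f))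
    & forall f, A f -> A (f \o f)].

Definition fibonacciLie (K : fieldType) : set (truncRing K -> truncRing K) :=
  smallest (@restricted_Lie_subalgebra K) [set pivot 1; pivot 2].
Arguments fibonacciLie : clear implicits.

(* The standard K-basis of fibonacciLie K is the union over n >= 1 of the sets
   {c v_n | c in basisCoef K n}. For n <= 3 the product in Wcoef is empty. *)
Definition Wcoef (K : fieldType) (n : nat) : set (truncRing K) :=
  [set \prod_(i < n - 3) truncVar K i ^+ alpha i
     | alpha in [set: {ffun 'I_(n - 3) -> bool}]].

Arguments Wcoef : clear implicits.

Definition basisCoef (K : fieldType) (n : nat) : set (truncRing K) :=
  if (n < 3)%N then Wcoef K n else Wcoef K n `|` [set truncVar K (n - 3)].
Arguments basisCoef : clear implicits.

Definition linear_span (K : fieldType) (V : lmodType K) (S : set V) : set V :=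
  smallest (fun A => GRing.submod_closed [in A]) S.

(* Main.v *)
(* Let R_k = K[t_0, ..., t_(k-1)], and consider the sums of r_j v_j over
   p <= j <= q with r_j in R_(j-2) and r_q without constant term. In
   characteristic 2 the square of such a sum is the sum of the squares
   (r_j v_j)^2 = r_j^2 t_(j-1) v_(j+2), where r_j^2 is a scalar, and of the
   brackets [r_i v_i, r_j v_j] = r_i v_i(r_j) v_j + r_i r_j [v_i, v_j] for i < j,
   where v_i(r_j) = 0 unless j >= i + 3 and [v_i, v_j] is a multiple of v_(j+1).
   Hence squaring raises p by 2 but q only by 1. With p = n and q = m + 1 (and
   r_(m+1) = 0) initially, no term is left after m - n + 2 squarings. *)

Require Import Defs.
From mathcomp Require Import all_boot all_algebra.
From mathcomp Require Import zify.
From mathcomp Require Import finmap monalg.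
From mathcomp Require Import boolp classical_sets functions.

Set Implicit Arguments.
Unset Strict Implicit.
Unset Printing Implicit Defensive.

Import GRing.Theory.

Local Open Scope classical_set_scope.
Local Open Scope ring_scope.

(** * Leibniz rule for the polynomial partial derivatives *)

Lemma polyPartialU (K : fieldType) (i : nat) (m : {cmonom nat}) (c : K) :
  polyPartial i (mkmalgU m c) = mkmalgU (divcm m (ucm i)) (c *+ m i).
Proof.
rewrite polyPartial.unlock msuppU.
case: eqVneq => [->|_]; first by rewrite big_nil mul0rn monalgU0.
by rewrite (big_seq_fset1 _ _) mcoeffUU.
Qed.

Lemma polyPartialMUU (K : fieldType) (i : nat) (m m' : {cmonom nat}) (c c' : K) :
  let p : polyRing K := mkmalgU m c in let q : polyRing K := mkmalgU m' c' in
  polyPartial i (p * q) = polyPartial i p * q + p * polyPartial i q.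
Proof.
have UU k k' (a b : K) :
    mkmalgU k a * mkmalgU k' b = mkmalgU (mmul k k') (a * b) :> polyRing K.
  by rewrite malgM_def fgmulUU.
(* [divcm] truncates exponents at 0, so the two monomials can differ when t_i does not divide [k];
   the coefficient is then 0. *)
have divU (k k' : {cmonom nat}) (a : K) :
    mkmalgU (divcm (mmul k k') (ucm i)) (a *+ k i)
    = mkmalgU (mmul (divcm k (ucm i)) k') (a *+ k i) :> polyRing K.
  have [->|ki] := posnP (k i); first by rewrite mulr0n !monalgU0.
  apply: (congr1 (fun l => mkmalgU l (a *+ k i))); apply/eqP/cmP => j.
  rewrite divcmE !cmM divcmE cmU; have [<-|_] := eqVneq; last by rewrite !subn0.
  by rewrite (addnBAC _ ki).
set u := ucm i; move=> p q.
have -> : polyPartial i p * q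
    = mkmalgU (mmul (divcm m u) m') (c * c' *+ m i) :> polyRing K.
  by rewrite polyPartialU UU mulrnAl.
have -> : p * polyPartial i q
    = mkmalgU (mmul (divcm m' u) m) (c * c' *+ m' i) :> polyRing K.
  by rewrite polyPartialU UU mulrnAr mulmC.
rewrite UU polyPartialU cmM mulrnDr monalgUD; apply: congr2; first exact: divU.
by rewrite (mulmC m m'); exact: divU.
Qed.

(* Over an abstract ring, since rewriting in [polyRing K] compares monomials by
   unfolding. *)
Lemma leibniz_sum (A : nzRingType) (D : {additive A -> A}) (I J : Type)
    (u : seq I) (w : seq J) (F : I -> A) (G : J -> A) :
  (forall i j, D (F i * G j) = D (F i) * G j + F i * D (G j)) ->
  D ((\sum_(i <- u) F i) * (\sum_(j <- w) G j))
  = D (\sum_(i <- u) F i) * (\sum_(j <- w) G j)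
    + (\sum_(i <- u) F i) * D (\sum_(j <- w) G j).
Proof.
move=> FG; rewrite !mulr_suml !raddf_sum mulr_suml -big_split.
apply: eq_bigr => i _.
rewrite !mulr_sumr raddf_sum -big_split; exact: eq_bigr.
Qed.

Lemma polyPartialM (K : fieldType) (i : nat) (p q : polyRing K) :
  polyPartial i (p * q) = polyPartial i p * q + p * polyPartial i q.
Proof.
rewrite (monalgE p) (monalgE q).
apply: (@leibniz_sum (polyRing K) (@polyPartial K i)) => m m'.
exact: polyPartialMUU.
Qed.

(** * Partial derivatives on the truncated ring *)

Section TruncPartial.
Variables (K : fieldType) (charK : 2%N \in [pchar K]).
Implicit Types (r s : truncRing K) (i j k : nat).

Lemma truncRing_pchar2 : 2%N \in [pchar truncRing K].
Proof.
rewrite inE /=; apply/eqP.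
by rewrite -[2%:R](scaler_nat 2 (1 : truncRing K)) (pcharf0 charK) scale0r.
Qed.

Lemma truncVar2 i : truncVar K i ^+ 2 = 0.
Proof.
rewrite /truncVar -rmorphXn; apply/eqP; rewrite truncPi_eq0; apply/asboolP.
by exists [:: (1, i)]; rewrite big_seq1 mul1r.
Qed.

Lemma truncPartialD i r s :
  truncPartial i (r + s) = truncPartial i r + truncPartial i s.
Proof.
by rewrite -(truncPiK r) -(truncPiK s) -raddfD !truncPartial_pi // !raddfD.
Qed.

Lemma truncPartialM i r s :
  truncPartial i (r * s) = truncPartial i r * s + r * truncPartial i s.
Proof.
rewrite -(truncPiK r) -(truncPiK s) -rmorphM !truncPartial_pi //.
rewrite polyPartialM; apply: etrans (rmorphD (@truncPi K) _ _) _.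
exact: congr2 (rmorphM _ _ _) (rmorphM _ _ _).
Qed.

Lemma truncPartialZ i c r : truncPartial i (c *: r) = c *: truncPartial i r.
Proof.
rewrite -(truncPiK r) -truncPiZ !truncPartial_pi // -truncPiZ.
apply: (congr1 (@truncPi K)); apply/malgP => k.
by rewrite mcoeff_polyPartial !mcoeffZ mcoeff_polyPartial mulrnAr.
Qed.

Lemma truncPartial_var i j : truncPartial i (truncVar K j) = (i == j)%:R.
Proof.
rewrite truncPartial_pi // polyVar.unlock polyPartialU cmU eq_sym.
have [<-|_] := eqVneq; last by rewrite monalgU0 raddf0.
rewrite (_ : divcm _ _ = mone) ?rmorph1 //.
by apply/eqP/cmP => l; rewrite divcmE subnn cm1.
Qed.

Lemma truncPartialC i j r :
  truncPartial i (truncPartial j r) = truncPartial j (truncPartial i r).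
Proof.
rewrite -(truncPiK r) !truncPartial_pi //; apply: (congr1 (@truncPi K)).
apply/malgP => k; rewrite !mcoeff_polyPartial !cmM -!mulrnA !cmU eq_sym.
rewrite -!mulmA (mulmC (ucm i)); apply: congr1.
by case: eqVneq => [->|_]; rewrite ?addn0 // mulnC.
Qed.

(** Differentiating twice in t_i multiplies coefficients by a product of two consecutive integers,
    which is even. *)
Lemma truncPartialK i r : truncPartial i (truncPartial i r) = 0.
Proof.
rewrite -(truncPiK r) !truncPartial_pi //.
rewrite (_ : polyPartial i _ = 0) ?raddf0 //.
apply/malgP => k; rewrite !mcoeff_polyPartial cmM cmUU mcoeff0 -mulrnA.
rewrite -mulr_natr (_ : _%:R = 0) ?mulr0 //; apply/eqP.
by rewrite -(dvdn_pcharf charK) dvdn2 addn1 oddM /=; case: odd.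
Qed.

End TruncPartial.

(** * Pivots as derivations, and the variables they involve *)

Section Pivot.
Variables (K : fieldType) (charK : 2%N \in [pchar K]).
Implicit Types (r s c : truncRing K) (i j k : nat).

Let addrr := addrr_pchar2 (truncRing_pchar2 charK).
Local Notation t := (truncVar K).
Local Notation D := truncPartial.

Lemma truncPartial0 i : D i (0 : truncRing K) = 0.
Proof. by apply: (@addrI _ (D i 0)); rewrite -truncPartialD // !addr0. Qed.

Lemma truncPartial1 i : D i (1 : truncRing K) = 0.
Proof.
have := truncPartialM charK i 1 1; rewrite !mulr1 mul1r.
by move=> /(congr1 (fun x => x - D i 1)); rewrite addrK subrr.
Qed.

(* As the characteristic is 2, this is the subring K[t_0, ..., t_(k-1)]. *)
Definition low k r := forall i, (k <= i)%N -> D i r = 0.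

Lemma lowW k k' r : (k <= k')%N -> low k r -> low k' r.
Proof. by move=> kk' rk i ki; apply: rk; apply: leq_trans ki. Qed.

Lemma low0 k : low k 0. Proof. by move=> i _; exact: truncPartial0. Qed.

Lemma low1 k : low k 1. Proof. by move=> i _; exact: truncPartial1. Qed.

Lemma lowD k r s : low k r -> low k s -> low k (r + s).
Proof. by move=> rk sk i ki; rewrite truncPartialD // rk // sk // addr0. Qed.

Lemma lowM k r s : low k r -> low k s -> low k (r * s).
Proof.
by move=> rk sk i ki; rewrite truncPartialM // rk // sk // mul0r mulr0 addr0.
Qed.

Lemma lowZ k a r : low k r -> low k (a *: r).
Proof. by move=> rk i ki; rewrite truncPartialZ // rk // scaler0. Qed.

Lemma low_var k i : (i < k)%N -> low k (t i).
Proof.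
by move=> ik j kj; rewrite truncPartial_var // gtn_eqF //; apply: leq_trans kj.
Qed.

Lemma low_partial k i r : low k r -> low k (D i r).
Proof. by move=> rk j kj; rewrite truncPartialC // rk // truncPartial0. Qed.

Lemma low_finite r : exists N, low N r.
Proof. exact: truncPartial_finite. Qed.

Lemma pivot_low i k r : (k <= i)%N -> low k r -> pivot i r = 0.
Proof.
move=> ki rk; rewrite (@pivotE _ i i) ?big_geq // => j ij.
by apply: rk; apply: leq_trans ij.
Qed.

Lemma pivotD i r s : pivot i (r + s) = pivot i r + pivot i s.
Proof.
have [N rN] := low_finite r; have [N' sN] := low_finite s.
have [M NM N'M] : exists2 M, (N <= M)%N & (N' <= M)%N.
  by exists (maxn N N'); rewrite leq_max leqnn ?orbT.
have rM := lowW NM rN; have sM := lowW N'M sN.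
rewrite !(@pivotE _ i M) //; last exact: lowD.
by rewrite -big_split; apply: eq_bigr => j _; rewrite truncPartialD // mulrDr.
Qed.

Lemma pivotM i r s : pivot i (r * s) = pivot i r * s + r * pivot i s.
Proof.
have [N rN] := low_finite r; have [N' sN] := low_finite s.
have [M NM N'M] : exists2 M, (N <= M)%N & (N' <= M)%N.
  by exists (maxn N N'); rewrite leq_max leqnn ?orbT.
have rM := lowW NM rN; have sM := lowW N'M sN.
rewrite !(@pivotE _ i M) //; last exact: lowM.
rewrite mulr_suml mulr_sumr -big_split; apply: eq_bigr => j _ /=.
by rewrite truncPartialM // mulrDr mulrA (mulrCA r).
Qed.

Lemma pivotMlow i k r s : (k <= i)%N -> low k r ->
  pivot i (r * s) = r * pivot i s.
Proof. by move=> ki rk; rewrite pivotM (pivot_low ki rk) mul0r add0r. Qed.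

Lemma pivot0 i : pivot i (0 : truncRing K) = 0.
Proof. exact: pivot_low (leq0n i) (@low0 0). Qed.

(** Downward induction on [i], suited to v_i = ∂_i + t_(i-1) v_(i+1): it starts beyond the finitely
    many variables of [r], where v_i kills [r]. *)
Lemma pivot_ind (P : nat -> truncRing K -> Prop) :
  (forall i r, low i r -> P i r) ->
  (forall i r, P i.+1 r -> P i r) ->
  forall i r, P i r.
Proof.
move=> P0 PS i r; have [N rN] := low_finite r.
have [d ed] : exists d, (N - i)%N = d by exists (N - i)%N.
elim: d i ed => [|d IHd] i ed; first by apply: P0; apply: lowW rN; lia.
by apply: PS; apply: IHd; lia.
Qed.

(** While i < k, the recursion only multiplies by t_(i-1), a variable of R_k; from i = k on, v_i
    kills [r]. *)
Lemma pivot_low_stable i k r : (0 < i)%N -> low k r -> low k (pivot i r).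
Proof.
move: i r; apply: pivot_ind => [i r ri _ _|i r IHi i0 rk].
  by rewrite (pivot_low (leqnn i) ri); exact: low0.
have [ki|ik] := leqP k i; first by rewrite (pivot_low ki rk); exact: low0.
rewrite pivot_rec //; apply: lowD; first exact: low_partial.
by apply: lowM; [apply: low_var; lia | exact: IHi].
Qed.

(** * Squares and brackets of pivots *)

(** The coefficients of v_j only involve t_(j-1) and later variables, all killed by ∂_i. *)
Lemma partial_pivot_far i j r : (0 < j)%N -> (i.+1 < j)%N ->
  D i (pivot j r) = pivot j (D i r).
Proof.
move: j r; apply: pivot_ind => [j r rj _ _|j r IHj j0 ij].
  by rewrite !(@pivot_low j j) // ?truncPartial0 //; exact: low_partial.
rewrite !(@pivot_rec _ j) // truncPartialD // truncPartialM // truncPartial_var //.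
have -> : (i == j.-1) = false by lia.
by rewrite mul0r add0r truncPartialC // IHj // ltnW.
Qed.

(** In v_(i+1) = ∂_(i+1) + t_i v_(i+2), the derivation ∂_i hits only the displayed factor t_i, so
    [∂_i, v_(i+1)] = v_(i+2). *)
Lemma partial_pivot_next i r :
  D i (pivot i.+1 r) = pivot i.+1 (D i r) + pivot i.+2 r.
Proof.
rewrite !(@pivot_rec _ i.+1) // truncPartialD // truncPartialM //=.
rewrite truncPartial_var // eqxx mul1r partial_pivot_far // truncPartialC //.
by rewrite (addrC (pivot i.+2 r)) addrA.
Qed.

(** Both summands of v_i = ∂_i + t_(i-1) v_(i+1) have square 0, which leaves their bracket t_(i-1)
    [∂_i, v_(i+1)]. *)
Lemma pivot_sq i r : (0 < i)%N ->
  pivot i (pivot i r) = t i.-1 * pivot i.+2 r.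
Proof.
move=> i0.
have ti : low i (t i.-1) by apply: low_var; lia.
rewrite (@pivot_rec _ i (pivot i r)) // !(@pivot_rec _ i r) // truncPartialD //.
rewrite truncPartialK // truncPartialM // ti // mul0r !add0r.
rewrite partial_pivot_next pivotD (@pivotMlow _ i) // mulrDr (mulrDr (t i.-1)).
rewrite (mulrA (t _) (t _)) -expr2 truncVar2 mul0r addr0.
by rewrite addrAC addrr add0r.
Qed.

(** Since v_j kills t_(i-1), [v_i, v_j] = [∂_i, v_j] + t_(i-1) [v_(i+1), v_j]. Iterating gives c =
    t_(i-1) ... t_(j-3). *)
Lemma pivot_comm i j : (0 < i)%N -> (i < j)%N ->
  exists2 c, low (j - 2) c &
    forall r, pivot i (pivot j r) + pivot j (pivot i r) = c * pivot j.+1 r.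
Proof.
have [d] := ubnP (j - i)%N; elim: d i => // d IHd i dij i0 ij.
have ti : low (j - 1) (t i.-1) by apply: low_var; lia.
have E r : pivot i (pivot j r) + pivot j (pivot i r) =
    D i (pivot j r) + pivot j (D i r)
    + t i.-1 * (pivot i.+1 (pivot j r) + pivot j (pivot i.+1 r)).
  rewrite !(@pivot_rec _ i) // pivotD (@pivotMlow _ (j - 1)) ?leq_subr //.
  by rewrite mulrDr addrACA.
(* For j = i + 1 the second bracket is 2 v_j^2 = 0; for larger [j] the first one vanishes. *)
have [ej|ij1] : j = i.+1 \/ (i.+1 < j)%N by lia.
  exists 1 => [|r]; first exact: low1.
  subst j; rewrite E partial_pivot_next addrr mulr0 addr0 mul1r.
  by rewrite addrAC addrr add0r.
have [|c cj cE] := IHd i.+1 _ isT ij1; first lia.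
exists (t i.-1 * c) => [|r]; first by apply: lowM => //; apply: low_var; lia.
have j0 : (0 < j)%N by apply: leq_ltn_trans ij.
by rewrite E partial_pivot_far // addrr add0r cE mulrA.
Qed.

(** * Squaring combinations of pivots *)

Lemma pivot_sum i m n (F : nat -> truncRing K) :
  pivot i (\sum_(m <= j < n) F j) = \sum_(m <= j < n) pivot i (F j).
Proof. exact: (big_morph _ (pivotD i) (pivot0 i)). Qed.

(* In characteristic 2, [r q ^+ 2 = 0] says that [r q] has no constant term. As
   [j - 2] is truncated, [r j] is a scalar for [j <= 2]. *)
Definition pivot_span p q (f : truncRing K -> truncRing K) :=
  exists r : nat -> truncRing K,
  [/\ forall j, low (j - 2) (r j), r q ^+ 2 = 0
    & forall x, f x = \sum_(p <= j < q.+1) r j * pivot j x].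

Lemma pivot_span0 p q : pivot_span p q (fun _ => 0).
Proof.
exists (fun _ => 0); split=> [j||x]; [exact: low0 | by rewrite expr0n |].
by rewrite big1 // => j _; rewrite mul0r.
Qed.

Lemma pivot_spanD p q f g : pivot_span p q f -> pivot_span p q g ->
  pivot_span p q (fun x => f x + g x).
Proof.
move=> [r [rl rq fE]] [s [sl sq gE]]; exists (fun j => r j + s j).
split=> [j||x]; first exact: lowD.
  by rewrite sqrrD rq sq add0r addr0 mulr2n addrr.
by rewrite fE gE -big_split; apply: eq_bigr => j _; rewrite mulrDl.
Qed.

Lemma pivot_span1 p q j c : (p <= j <= q)%N -> low (j - 2) c ->
  (j = q -> c ^+ 2 = 0) -> pivot_span p q (fun x => c * pivot j x).
Proof.
move=> pjq cj cq; exists (fun k => if k == j then c else 0).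
split=> [k||x]; first by case: eqVneq => [->|_] //; exact: low0.
  by case: eqVneq => [/esym/cq|_] //; rewrite expr0n.
rewrite (bigD1_seq j) ?iota_uniq ?mem_index_iota //= eqxx big1 ?addr0 // => k.
by move=> /negPf ->; rewrite mul0r.
Qed.

Lemma pivot_span_sum p q m n (F : nat -> truncRing K -> truncRing K) :
  (forall j, (m <= j < n)%N -> pivot_span p q (F j)) ->
  pivot_span p q (fun x => \sum_(m <= j < n) F j x).
Proof.
move=> FS; rewrite -fct_sumE big_nat; elim/big_ind: _ => //.
  exact: pivot_span0.
exact: pivot_spanD.
Qed.

Lemma pivot_span_sqr1 p q j c : (0 < p)%N -> (p <= j <= q)%N ->
  low (j - 2) c -> (j = q -> c ^+ 2 = 0) ->
  pivot_span p.+2 q.+1 (fun x => c * pivot j (c * pivot j x)).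
Proof.
move=> p0 /andP[pj jq] cj cq; have j0 : (0 < j)%N by apply: leq_trans pj.
have -> : (fun x => c * pivot j (c * pivot j x)) =
    (fun x => (c ^+ 2 * t j.-1) * pivot j.+2 x).
  apply/funext => x; rewrite (@pivotMlow _ (j - 2)) ?leq_subr // pivot_sq //.
  by rewrite expr2 !mulrA.
(* For j = q the index j + 2 would leave the range, but c^2 = 0. *)
have [ej|jq'] := eqVneq j q.
  rewrite cq // mul0r; apply: eq_ind (pivot_span0 _ _) _ _.
  by apply/funext => x; rewrite mul0r.
apply: pivot_span1 => [||_]; first by rewrite !ltnS pj; lia.
  rewrite expr2; apply: lowM; last by apply: low_var; lia.
  by apply: lowM; apply: lowW cj; lia.
(* If j + 2 is the new top index, the factor t_(j-1) makes the coefficient square to 0. *)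
by rewrite exprMn truncVar2 mulr0.
Qed.

Lemma pivot_span_comm p q i j b c : (0 < p)%N -> (p <= i < j)%N -> (j <= q)%N ->
  low (i - 2) b -> low (j - 2) c -> (j = q -> c ^+ 2 = 0) ->
  pivot_span p.+2 q.+1
    (fun x => b * pivot i (c * pivot j x) + c * pivot j (b * pivot i x)).
Proof.
move=> p0 /andP[pi ij] jq bi cj cq; have i0 : (0 < i)%N by apply: leq_trans pi.
have [e ej eE] := pivot_comm i0 ij.
have -> : (fun x => b * pivot i (c * pivot j x) + c * pivot j (b * pivot i x)) =
    (fun x => b * pivot i c * pivot j x + b * c * e * pivot j.+1 x).
  apply/funext => x; rewrite pivotM (@pivotMlow j (i - 2)) //; last lia.
  by rewrite mulrDr !mulrA (mulrC c b) -addrA -mulrDr eE !mulrA.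
have bj : low (j - 2) b by apply: lowW bi; lia.
apply: pivot_spanD.
  (* Either v_i kills [c], or j > i + 2 and v_j already lies above the new lower bound. *)
  have [ji|ji] := leqP (j - 2) i.
    rewrite (pivot_low ji cj) mulr0; apply: eq_ind (pivot_span0 _ _) _ _.
    by apply/funext => x; rewrite mul0r.
  apply: pivot_span1; [lia | | lia].
  by apply: lowM => //; exact: pivot_low_stable.
apply: pivot_span1 => [||[jq']]; first by rewrite !ltnS jq; lia.
  by apply: lowW (lowM (lowM bj cj) ej); lia.
(* The new top index j + 1 = q + 1 occurs only for j = q, where c^2 = 0. *)
by rewrite !exprMn cq // mulr0 mul0r.
Qed.

Lemma pivot_span_sqr p q f : (0 < p)%N -> pivot_span p q f ->
  pivot_span p.+2 q.+1 (fun x => f (f x)).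
Proof.
move=> p0 [r [rl rq fE]].
pose F h x := \sum_(p <= j < h) r j * pivot j x.
(* Induction on partial sums with the target range fixed, so that the condition on [r q] is used
   only for the last term. *)
suff FF h : (h <= q.+1)%N -> pivot_span p.+2 q.+1 (fun x => F h (F h x)).
  by rewrite (_ : f = F q.+1); [exact: FF | exact/funext].
elim: h => [_|h IHh hq].
  rewrite (_ : (fun x => _) = (fun _ => 0)); first exact: pivot_span0.
  by apply/funext => x; rewrite /F big_geq.
have [hp|ph] := ltnP h p.
  rewrite (_ : (fun x => _) = (fun _ => 0)); first exact: pivot_span0.
  by apply/funext => x; rewrite /F big_geq.
have rq' : h = q -> r h ^+ 2 = 0 by move=> ->.
have FS y : F h.+1 y = F h y + r h * pivot h y by rewrite /F big_nat_recr.
have FD y z : F h (y + z) = F h y + F h z.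
  by rewrite /F -big_split; apply: eq_bigr => j _; rewrite pivotD mulrDr.
(* A new term contributes its own square and its brackets with the earlier terms. *)
have -> : (fun x => F h.+1 (F h.+1 x)) = (fun x => F h (F h x)
    + r h * pivot h (r h * pivot h x)
    + \sum_(p <= j < h) (r j * pivot j (r h * pivot h x)
                         + r h * pivot h (r j * pivot j x))).
  apply/funext => x; rewrite big_split /= -mulr_sumr -pivot_sum -/(F h _) -/(F h x).
  by rewrite !FS FD pivotD mulrDr [r h * pivot h (F h x) + _]addrC addrACA.
apply: pivot_spanD; first apply: pivot_spanD.
- by apply: IHh; exact: ltnW.
- by apply: pivot_span_sqr1 => //; rewrite ph.
- by apply: pivot_span_sum => j pjh; exact: pivot_span_comm.
Qed.

Lemma pivot_span_iter n q f k : (0 < n)%N -> pivot_span n q f ->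
  pivot_span (n + k.*2) (q + k) (iter (2 ^ k) f).
Proof.
move=> n0 fS; elim: k => [|k IHk]; first by rewrite !addn0.
have -> : iter (2 ^ k.+1) f = (fun x => iter (2 ^ k) f (iter (2 ^ k) f x)).
  by apply/funext => x; rewrite expnS mul2n -addnn iterD.
by rewrite doubleS !addnS; apply: pivot_span_sqr IHk; rewrite addn_gt0 n0.
Qed.

(** * Basis coefficients and nilpotency *)

Lemma basisCoef_low j c : basisCoef K j c -> low (j - 2) c.
Proof.
have Wl : Wcoef K j c -> low (j - 2) c.
  case=> alpha _ <-; elim/big_ind: _ => [||i _]; [exact: low1 | exact: lowM |].
  case: (alpha i); last exact: low1.
  by apply: low_var; have := ltn_ord i; lia.
rewrite /basisCoef; case: ltnP => // j3 [//|->].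
(* The extra coefficient t_(j-3) is what makes the bound j - 2 instead of j - 3. *)
by apply: low_var; lia.
Qed.

Lemma linear_span_low j c : linear_span (basisCoef K j) c -> low (j - 2) c.
Proof.
move=> /(_ [set c | low (j - 2) c]); apply; split; last exact: basisCoef_low.
split=> [|a u v]; rewrite !inE; first exact: low0.
by move=> uj vj; apply: lowD => //; exact: lowZ.
Qed.

End Pivot.

(* MathComp world; r j is the coefficient of v_j, written r_{j-3} in the source. *)
Theorem corollary18 (K : fieldType) (charK : 2%N \in [pchar K])
    (a : truncRing K -> truncRing K) (aL : fibonacciLie K a) (a_neq0 : a <> 0)
    (n m : nat) (n_gt0 : (1 <= n)%N) (le_nm : (n <= m)%N)
    (r : nat -> truncRing K)
    (r_coef : forall j, (n <= j <= m)%N -> linear_span (basisCoef K j) (r j))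
    (aE : a = \sum_(n <= j < m.+1) (r j \*o pivot j)) :
  iter (2 ^ (m - n + 2)) a = 0.
Proof.
have aS : pivot_span n m.+1 a.
  (* [r m] may have a constant term, so the top index is raised to m + 1 with coefficient 0. *)
  exists (fun j => if (n <= j <= m)%N then r j else 0); split=> [j||x].
  - by case: ifP => [/r_coef/linear_span_low|_]; [apply | exact: low0].
  - by rewrite ltnn andbF expr0n.
  rewrite aE fct_sumE [RHS]big_nat_recr /=; last exact: leqW.
  rewrite ltnn andbF mul0r addr0.
  by apply: eq_big_nat => j; rewrite ltnS => ->.
have [s [_ _ sE]] := pivot_span_iter charK (m - n + 2) n_gt0 aS.
(* The range now starts at 2m - n + 4 and ends at 2m - n + 3. *)
by apply/funext => x; rewrite sE big_geq //; lia.
Qed.
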